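(* Let $\mathbb F$ be a field, let $q\in\mathbb F$ be nonzero with $q^2\ne1$, let $N\in\mathbb N$, and let $V$ be a vector space over $\mathbb F$ with dimension $N+1$. Let $B$ be a Billiard Array on $V$. Assume that each white 3-clique in $\Delta_N$ has $B$-value $q^{-2}$. Then there exists a unique $U_q(\mathfrak{sl}_2)$-module structure on $V$ such that for $0\le i\le N$, $x-q^{N-2i}I$ (resp. $y-q^{N-2i}I$) (resp. $z-q^{N-2i}I$) vanishes on component $i$ of the $B$-decomposition $[2,3]$ (resp. $[3,1]$) (resp. $[1,2]$) of $V$. The $U_q(\mathfrak{sl}_2)$-module $V$ is irreducible, provided that $q^{2i}\ne1$ for $1\le i\le N$.
   Context: $U_q(\mathfrak{sl}_2)$ denotes the associative $\mathbb F$-algebra (equitable presentation) with generators $x,y^{\pm1},z$ and relations $yy^{-1}=1$, $y^{-1}y=1$, $$\frac{qxy-q^{-1}yx}{q-q^{-1}}=1,\qquad \frac{qyz-q^{-1}zy}{q-q^{-1}}=1,\qquad \frac{qzx-q^{-1}xz}{q-q^{-1}}=1.$$ $I$ is the identity map on $V$. $\mathbb N=\{0,1,2,\ldots\}$. $\Delta_n=\{(r,s,t): r,s,t\in\mathbb N,\ r+s+t=n\}$, whose elements are called locations. A line in $\Delta_N$ is a set consisting of all locations whose $\eta$-coordinate equals a fixed number $m$, for some $\eta\in\{1,2,3\}$ and some $0\le m\le N$. Locations $\lambda,\mu$ are adjacent if $\lambda-\mu$ is one of $\pm(1,-1,0),\pm(0,1,-1),\pm(-1,0,1)$. For $N\ge1$,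 a black 3-clique in $\Delta_N$ is a set $\{(r+1,s,t),(r,s+1,t),(r,s,t+1)\}$ with $(r,s,t)\in\Delta_{N-1}$. Each pair of adjacent locations is contained in a unique black 3-clique. For $N\ge2$, a white 3-clique in $\Delta_N$ is a set $\{(r,s+1,t+1),(r+1,s,t+1),(r+1,s+1,t)\}$ with $(r,s,t)\in\Delta_{N-2}$; for $N\le1$ there are none. Let $\mathcal P_1(V)$ be the set of one-dimensional subspaces of $V$. A Billiard Array on $V$ is a function $B:\Delta_N\to\mathcal P_1(V)$, $\lambda\mapsto B_\lambda$, such that (i) for each line $L$ in $\Delta_N$ the sum $\sum_{\lambda\in L}B_\lambda$ is direct; (ii) for each black 3-clique $C$ in $\Delta_N$ the sum $\sum_{\lambda\in C}B_\lambda$ is not direct. For adjacent $\lambda,\mu\in\Delta_N$, let $\nu$ be the unique location such that $\lambda,\mu,\nu$ form a black 3-clique. For each nonzero $u\in B_\lambda$ there is a unique nonzero $v\in B_\mu$ with $u+v\in B_\nu$; the $\mathbb F$-linear bijection $\tilde B_{\lambda,\mu}:B_\lambda\to B_\mu$ sends $u\mapsto v$. For a white 3-clique $\lambda=(r,s+1,t+1)$, $\mu=(r+1,s,t+1)$, $\nu=(r+1,s+1,t)$, the composition $\tilde B_{\nu,\lambda}\circ\tilde B_{\mu,\nu}\circ\tilde B_{\lambda,\mu}:B_\lambda\to B_\lambda$ is a nonzero scalar multiple of the identity; this scalar is the $B$-value of the white 3-clique. The $B$-decompositions $[2,3]$, $[3,1]$, $[1,2]$ of $V$ are the sequences of one-dimensional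 subspaces whose $i$-component ($0\le i\le N$) is $B_{(0,N-i,i)}$, $B_{(i,0,N-i)}$, $B_{(N-i,i,0)}$ respectively; in each case $V$ is the direct sum of the components. *)

(* Defs.v *)
From HB Require Import structures.
From mathcomp Require Import all_boot all_algebra generic_quotient.
From mathcomp Require Import boolp classical_sets.

Set Implicit Arguments.
Unset Strict Implicit.
Unset Printing Implicit Defensive.

Import GRing.Theory.
Local Open Scope ring_scope.
Local Open Scope quotient_scope.

(* Associative unital algebras by generators and relations: formal
   noncommutative polynomials modulo the least congruence containing the
   algebra axioms and the given relations. *)
Section Presentation.
Variables (F : fieldType) (G : Type).

Inductive expr : Type :=
  | EGen of G
  | EConst of F
  | EAdd of expr & expr
  | EOpp of expr
  | EMul of expr & expr.

HB.instance Definition _ := gen_eqMixin expr.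
HB.instance Definition _ := gen_choiceMixin expr.

Variable rels : expr -> expr -> Prop.

Inductive pcong : expr -> expr -> Prop :=
  | pcong_refl a : pcong a a
  | pcong_sym a b : pcong a b -> pcong b a
  | pcong_trans a b c : pcong a b -> pcong b c -> pcong a c
  | pcong_add a a' b b' :
      pcong a a' -> pcong b b' -> pcong (EAdd a b) (EAdd a' b')
  | pcong_opp a a' : pcong a a' -> pcong (EOpp a) (EOpp a')
  | pcong_mul a a' b b' :
      pcong a a' -> pcong b b' -> pcong (EMul a b) (EMul a' b')
  | pcong_addA a b c : pcong (EAdd a (EAdd b c)) (EAdd (EAdd a b) c)
  | pcong_addC a b : pcong (EAdd a b) (EAdd b a)
  | pcong_add0 a : pcong (EAdd (EConst 0) a) a
  | pcong_addN a : pcong (EAdd (EOpp a) a) (EConst 0)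
  | pcong_mulA a b c : pcong (EMul a (EMul b c)) (EMul (EMul a b) c)
  | pcong_mul1 a : pcong (EMul (EConst 1) a) a
  | pcong_mulDl a b c :
      pcong (EMul (EAdd a b) c) (EAdd (EMul a c) (EMul b c))
  | pcong_mulDr a b c :
      pcong (EMul a (EAdd b c)) (EAdd (EMul a b) (EMul a c))
  | pcong_constD k l : pcong (EConst (k + l)) (EAdd (EConst k) (EConst l))
  | pcong_constM k l : pcong (EConst (k * l)) (EMul (EConst k) (EConst l))
  | pcong_constC k a : pcong (EMul (EConst k) a) (EMul a (EConst k))
  | pcong_rel a b : rels a b -> pcong a b.

Definition pcongb : rel expr := fun a b => `[< pcong a b >].

Lemma pcongb_refl : reflexive pcongb.
Proof. by move=> a; apply/asboolP; exact: pcong_refl. Qed.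

Lemma pcongb_sym : symmetric pcongb.
Proof. by move=> a b; apply/asboolP/asboolP; exact: pcong_sym. Qed.

Lemma pcongb_trans : transitive pcongb.
Proof.
move=> b a c /asboolP ab /asboolP bc; apply/asboolP; exact: pcong_trans ab bc.
Qed.

Definition pcong_equiv := EquivRel pcongb pcongb_refl pcongb_sym pcongb_trans.

Definition palg := {eq_quot pcong_equiv}.
HB.instance Definition _ := Choice.on palg.

Definition pclass (a : expr) : palg := \pi_palg a.
Definition palg_gen (g : G) : palg := pclass (EGen g).

Lemma pclassP (a b : expr) : pclass a = pclass b <-> pcong a b.
Proof.
split=> [/eqmodP /asboolP //|ab]; by apply/eqmodP/asboolP.
Qed.

Lemma pclass_repr (u : palg) : pclass (repr u) = u.
Proof. exact: reprK. Qed.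

Lemma repr_pclass (a : expr) : pcong (repr (pclass a)) a.
Proof. by apply/pclassP; rewrite pclass_repr. Qed.

Definition palg_add (u v : palg) := pclass (EAdd (repr u) (repr v)).
Definition palg_opp (u : palg) := pclass (EOpp (repr u)).
Definition palg_mul (u v : palg) := pclass (EMul (repr u) (repr v)).
Definition palg_scale (k : F) (u : palg) := palg_mul (pclass (EConst k)) u.

Lemma palg_addE a b : palg_add (pclass a) (pclass b) = pclass (EAdd a b).
Proof. by apply/pclassP; apply: pcong_add; exact: repr_pclass. Qed.

Lemma palg_oppE a : palg_opp (pclass a) = pclass (EOpp a).
Proof. by apply/pclassP; apply: pcong_opp; exact: repr_pclass. Qed.

Lemma palg_mulE a b : palg_mul (pclass a) (pclass b) = pclass (EMul a b).
Proof. by apply/pclassP; apply: pcong_mul; exact: repr_pclass. Qed.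

Lemma palg_ind (P : palg -> Prop) : (forall a, P (pclass a)) -> forall u, P u.
Proof. by move=> Pa u; rewrite -(pclass_repr u). Qed.

Let palgE := (palg_addE, palg_oppE, palg_mulE).

Fact palg_addA : associative palg_add.
Proof.
elim/palg_ind=> a; elim/palg_ind=> b; elim/palg_ind=> c.
by rewrite !palgE; apply/pclassP; exact: pcong_addA.
Qed.

Fact palg_addC : commutative palg_add.
Proof.
elim/palg_ind=> a; elim/palg_ind=> b.
by rewrite !palgE; apply/pclassP; exact: pcong_addC.
Qed.

Fact palg_add0 : left_id (pclass (EConst 0)) palg_add.
Proof.
by elim/palg_ind=> a; rewrite !palgE; apply/pclassP; exact: pcong_add0.
Qed.

Fact palg_addN : left_inverse (pclass (EConst 0)) palg_opp palg_add.
Proof.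
by elim/palg_ind=> a; rewrite !palgE; apply/pclassP; exact: pcong_addN.
Qed.

Fact palg_mulA : associative palg_mul.
Proof.
elim/palg_ind=> a; elim/palg_ind=> b; elim/palg_ind=> c.
by rewrite !palgE; apply/pclassP; exact: pcong_mulA.
Qed.

Fact palg_mul1l : left_id (pclass (EConst 1)) palg_mul.
Proof.
by elim/palg_ind=> a; rewrite !palgE; apply/pclassP; exact: pcong_mul1.
Qed.

Fact palg_constC k u :
  palg_mul (pclass (EConst k)) u = palg_mul u (pclass (EConst k)).
Proof.
elim/palg_ind: u => a.
by rewrite !palgE; apply/pclassP; exact: pcong_constC.
Qed.

Fact palg_mul1r : right_id (pclass (EConst 1)) palg_mul.
Proof. by move=> u; rewrite -palg_constC palg_mul1l. Qed.

Fact palg_mulDl : left_distributive palg_mul palg_add.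
Proof.
elim/palg_ind=> a; elim/palg_ind=> b; elim/palg_ind=> c.
by rewrite !palgE; apply/pclassP; exact: pcong_mulDl.
Qed.

Fact palg_mulDr : right_distributive palg_mul palg_add.
Proof.
elim/palg_ind=> a; elim/palg_ind=> b; elim/palg_ind=> c.
by rewrite !palgE; apply/pclassP; exact: pcong_mulDr.
Qed.

HB.instance Definition _ := GRing.isZmodule.Build palg
  palg_addA palg_addC palg_add0 palg_addN.

(* Only a possibly trivial ring: the relations may force 1 = 0. *)
HB.instance Definition _ := GRing.Zmodule_isPzRing.Build palg
  palg_mulA palg_mul1l palg_mul1r palg_mulDl palg_mulDr.

Fact palg_scaleA k l u : palg_scale k (palg_scale l u) = palg_scale (k * l) u.
Proof.
rewrite /palg_scale palg_mulA palg_mulE; congr palg_mul.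
by apply/pclassP/pcong_sym; exact: pcong_constM.
Qed.

Fact palg_scale1 : left_id 1 palg_scale.
Proof. exact: palg_mul1l. Qed.

Fact palg_scaleDr : right_distributive palg_scale +%R.
Proof. by move=> k u v; exact: palg_mulDr. Qed.

Fact palg_scaleDl u : {morph palg_scale^~ u : k l / k + l}.
Proof.
move=> k l; rewrite /palg_scale.
suff -> : pclass (EConst (k + l)) =
          palg_add (pclass (EConst k)) (pclass (EConst l)).
  exact: palg_mulDl.
by rewrite palg_addE; apply/pclassP; exact: pcong_constD.
Qed.

HB.instance Definition _ := GRing.Zmodule_isLmodule.Build F palg
  palg_scaleA palg_scale1 palg_scaleDr palg_scaleDl.

Lemma palg_scalerAl (k : F) (u v : palg) : k *: (u * v) = (k *: u) * v.
Proof. exact: palg_mulA. Qed.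

Lemma palg_scalerAr (k : F) (u v : palg) : k *: (u * v) = u * (k *: v).
Proof.
change (palg_mul (pclass (EConst k)) (palg_mul u v) =
        palg_mul u (palg_mul (pclass (EConst k)) v)).
by rewrite palg_mulA palg_constC -palg_mulA.
Qed.

End Presentation.

Section Uqsl2.
Variables (F : fieldType) (q : F).

Inductive uq_gen : Type := GX | GY | GYinv | GZ.

Let E := expr F uq_gen.

(* (q a b - q^-1 b a) / (q - q^-1) *)
Definition qcomm (a b : E) : E :=
  EMul (EConst _ (q - q^-1)^-1)
    (EAdd (EMul (EConst _ q) (EMul a b))
          (EOpp (EMul (EConst _ q^-1) (EMul b a)))).

Let x : E := EGen F GX.
Let y : E := EGen F GY.
Let yinv : E := EGen F GYinv.
Let z : E := EGen F GZ.

Inductive uq_rel : E -> E -> Prop :=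
  | uq_yyinv : uq_rel (EMul y yinv) (EConst _ 1)
  | uq_yinvy : uq_rel (EMul yinv y) (EConst _ 1)
  | uq_xy : uq_rel (qcomm x y) (EConst _ 1)
  | uq_yz : uq_rel (qcomm y z) (EConst _ 1)
  | uq_zx : uq_rel (qcomm z x) (EConst _ 1).

Definition Uq := palg uq_rel.
HB.instance Definition _ := GRing.PzRing.on Uq.
HB.instance Definition _ := GRing.Lmodule.on Uq.

Definition Ux : Uq := palg_gen uq_rel GX.
Definition Uy : Uq := palg_gen uq_rel GY.
Definition Uyinv : Uq := palg_gen uq_rel GYinv.
Definition Uz : Uq := palg_gen uq_rel GZ.

Lemma Uq_yyinv : Uy * Uyinv = 1.
Proof.
transitivity (pclass uq_rel (EMul y yinv)); first exact: palg_mulE.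
by apply/pclassP/pcong_rel; exact: uq_yyinv.
Qed.

Lemma Uq_yinvy : Uyinv * Uy = 1.
Proof.
transitivity (pclass uq_rel (EMul yinv y)); first exact: palg_mulE.
by apply/pclassP/pcong_rel; exact: uq_yinvy.
Qed.

Lemma qcommE (a b : E) : pclass uq_rel (qcomm a b) =
  (q - q^-1)^-1 *: (q *: (pclass uq_rel a * pclass uq_rel b : Uq)
                    - q^-1 *: (pclass uq_rel b * pclass uq_rel a : Uq)) :> Uq.
Proof.
rewrite /qcomm -palg_mulE -palg_addE -palg_oppE.
by rewrite -!palg_mulE.
Qed.

Lemma Uq_xy : (q - q^-1)^-1 *: (q *: (Ux * Uy) - q^-1 *: (Uy * Ux)) = 1.
Proof.
rewrite -qcommE; apply/pclassP/pcong_rel; exact: uq_xy.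
Qed.

Lemma Uq_yz : (q - q^-1)^-1 *: (q *: (Uy * Uz) - q^-1 *: (Uz * Uy)) = 1.
Proof.
rewrite -qcommE; apply/pclassP/pcong_rel; exact: uq_yz.
Qed.

Lemma Uq_zx : (q - q^-1)^-1 *: (q *: (Uz * Ux) - q^-1 *: (Ux * Uz)) = 1.
Proof.
rewrite -qcommE; apply/pclassP/pcong_rel; exact: uq_zx.
Qed.

Variable V : vectType F.

(* Compatible with the given F-vector space structure of V. *)
Record is_Uq_module (act : Uq -> V -> V) : Prop := IsUqModule {
  uqmodDr : forall a v w, act a (v + w) = act a v + act a w;
  uqmodZr : forall a (k : F) v, act a (k *: v) = k *: act a v;
  uqmodDl : forall a b v, act (a + b) v = act a v + act b v;
  uqmodZl : forall (k : F) a v, act (k *: a) v = k *: act a v;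
  uqmod1 : forall v, act 1 v = v;
  uqmodM : forall a b v, act (a * b) v = act a (act b v)
}.

Definition uq_submodule (act : Uq -> V -> V) (W : {vspace V}) : Prop :=
  forall a w, w \in W -> act a w \in W.

Definition uq_irreducible (act : Uq -> V -> V) : Prop :=
  fullv != 0%VS :> {vspace V} /\
  forall W : {vspace V}, uq_submodule act W -> W = 0%VS \/ W = fullv.

End Uqsl2.

Definition Delta (n : nat) : finType :=
  {l : 'I_n.+1 * 'I_n.+1 * 'I_n.+1 | (l.1.1 + l.1.2 + l.2 == n)%N}.

Definition coords (n : nat) (l : Delta n) : nat * nat * nat :=
  let: (r, s, t) := val l in (nat_of_ord r, nat_of_ord s, nat_of_ord t).

(* The coordinates 1, 2, 3 are indexed by 0, 1, 2. *)
Definition coord (n : nat) (eta : 'I_3) (l : Delta n) : nat :=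
  let: (r, s, t) := coords l in nth 0%N [:: r; s; t] eta.

Section Location.
Variables (n r s t : nat) (h : (r + s + t = n)%N).

Fact loc_lt1 : (r < n.+1)%N.
Proof. by rewrite ltnS -h -addnA leq_addr. Qed.
Fact loc_lt2 : (s < n.+1)%N.
Proof. by rewrite ltnS -h addnAC leq_addl. Qed.
Fact loc_lt3 : (t < n.+1)%N.
Proof. by rewrite ltnS -h leq_addl. Qed.
Fact loc_sum : (Ordinal loc_lt1 + Ordinal loc_lt2 + Ordinal loc_lt3 == n)%N.
Proof. exact/eqP. Qed.

Definition loc : Delta n :=
  exist _ (Ordinal loc_lt1, Ordinal loc_lt2, Ordinal loc_lt3) loc_sum.

Lemma coords_loc : coords loc = (r, s, t).
Proof. by []. Qed.
End Location.

Definition is_line (N : nat) (L : {set Delta N}) : Prop :=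
  exists (eta : 'I_3) (m : nat),
    (m <= N)%N /\ L = [set l | coord eta l == m].

(* The condition (r + s + t).+1 = N says (r, s, t) \in Delta_(N-1), with N >= 1. *)
Definition black_clique (N : nat) (C : {set Delta N}) : Prop :=
  exists r s t : nat, (r + s + t).+1 = N /\
    C = [set l | coords l \in [:: (r.+1, s, t); (r, s.+1, t); (r, s, t.+1)]].

(* A white 3-clique, listed in the cyclic order used to define its B-value. *)
Definition white_clique (N : nat) (l m n : Delta N) : Prop :=
  exists r s t : nat, (r + s + t).+2 = N /\
    [/\ coords l = (r, s.+1, t.+1), coords m = (r.+1, s, t.+1)
      & coords n = (r.+1, s.+1, t)].

Section BilliardArray.
Variables (F : fieldType) (V : vectType F) (N : nat).
Implicit Types (B : Delta N -> {vspace V}).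

Record billiard_array B : Prop := BilliardArray {
  billiard_dim1 : forall l, \dim (B l) = 1%N;
  billiard_line : forall L : {set Delta N},
    is_line L -> directv (\sum_(l in L) B l);
  billiard_black : forall C : {set Delta N},
    black_clique C -> ~~ directv (\sum_(l in C) B l)
}.

(* \tilde B_{l,m} on B_l, for adjacent l and m: it sends a nonzero u to the
   unique v below, and 0 to the default value 0. *)
Definition Btilde B (l m : Delta N) (u : V) : V :=
  xget 0 (fun v : V => [/\ v \in B m, v != 0 &
    exists n : Delta N, black_clique [set l; m; n] /\ u + v \in B n]).

Definition has_Bvalue B (l m n : Delta N) (a : F) : Prop :=
  forall u, u \in B l -> Btilde B n l (Btilde B m n (Btilde B l m u)) = a *: u.

Fact comp23_sum (i : 'I_N.+1) : (0 + (N - i) + i = N)%N.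
Proof. by rewrite add0n subnK // -ltnS. Qed.
Fact comp31_sum (i : 'I_N.+1) : (i + 0 + (N - i) = N)%N.
Proof. by rewrite addn0 subnKC // -ltnS. Qed.
Fact comp12_sum (i : 'I_N.+1) : ((N - i) + i + 0 = N)%N.
Proof. by rewrite addn0 subnK // -ltnS. Qed.

Definition decomp23 B (i : 'I_N.+1) : {vspace V} := B (loc (comp23_sum i)).
Definition decomp31 B (i : 'I_N.+1) : {vspace V} := B (loc (comp31_sum i)).
Definition decomp12 B (i : 'I_N.+1) : {vspace V} := B (loc (comp12_sum i)).

End BilliardArray.

(* N - 2 i is an integer, possibly negative, hence the exponent in int. *)
Definition vanishing (F : fieldType) (q : F) (V : vectType F) (N : nat)
    (B : Delta N -> {vspace V}) (act : Uq q -> V -> V) : Prop :=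
  forall i : 'I_N.+1,
  [/\ forall v, v \in decomp23 B i ->
        act (Ux q) v - q ^ (N%:Z - 2 * i%:Z) *: v = 0,
      forall v, v \in decomp31 B i ->
        act (Uy q) v - q ^ (N%:Z - 2 * i%:Z) *: v = 0
    & forall v, v \in decomp12 B i ->
        act (Uz q) v - q ^ (N%:Z - 2 * i%:Z) *: v = 0].

(* Main.v *)
From HB Require Import structures.
Require Import Defs.
From mathcomp Require Import all_boot all_algebra.
From mathcomp Require Import generic_quotient boolp.
From mathcomp Require classical_sets.
From mathcomp Require Import zify ring.

(** Why the theorem holds.  Write (r, s, t) for a location and think of t as
the number of a row.  Pick a nonzero e_0 in the corner (N, 0, 0) and walk along
the edge t = 0, choosing e_(s+1) in the location (N-s-1, s+1, 0) so that
e_s - e_(s+1) lies in the location of the next row that completes the black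
3-clique ([edge_family]).  This is a basis of V.  The differences e_s - e_(s+1)
span the entries of row 1, but they are not normalized in the same way as the
e_s: the white 3-clique value q^-2 says exactly that the rescaled vectors
q^(2s) (e_s - e_(s+1)) again have consecutive differences in row 2
([white_step]).  Iterating, the family
    b_0(s) = e_s,   b_(t+1)(s) = q^(2s) (b_t(s) - b_t(s+1))
has b_t(s) nonzero in the location (N-s-t, s, t) ([row_family_entry]).  So the
whole array is an explicit function of the basis e.

The conditions imposed on z say that Z e_s = q^(N-2s) e_s.  Define X and Y as
bidiagonal maps on the same basis,
    X e_s = q^(2s-N) e_s + (q^N  - q^(2s-N)) e_(s+1),
    Y e_s = q^(2s-N) e_s + (q^-N - q^(2s-N)) e_(s-1).
The recursion for b carries these formulas from row to row ([raising_row],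
[lowering_row]):
    X b_t(s) = q^(2s-N) b_t(s) + (q^(N-2t) - q^(2s-N)) b_t(s+1),
    Y b_t(s) = q^(2s+2t-N) b_t(s) + (q^(2t-N) - q^(2s+2t-N)) b_t(s-1).
The second coefficient of X vanishes on the edge s + t = N and that of Y on the
edge s = 0, so X and Y are diagonal there, with the required eigenvalues.
The relations of the algebra are a computation on the basis e.

Each of the three edges spans V, so x, y, z, hence also the inverse of y, are
determined by their action there: this is uniqueness.  For irreducibility,
XZ - 1 sends e_s to a multiple of e_(s+1) and YZ - 1 sends e_s to a multiple of
e_(s-1); the multipliers q^(2N-2s) - 1 and q^(-2s) - 1 are nonzero under the
hypothesis on q, so that any nonzero submodule contains e_N and then every
e_s ([stable_subspace_trivial]). *)

Set Implicit Arguments.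
Unset Strict Implicit.
Unset Printing Implicit Defensive.

Import GRing.Theory.
Local Open Scope ring_scope.

(** * Modules over the equitable algebra *)

Section Modules.
Variables (F : fieldType) (q : F) (V : vectType F).

Section Evaluation.
Variables X Y Yi Z : 'End(V).

Definition gen_op (g : uq_gen) : 'End(V) :=
  match g with GX => X | GY => Y | GYinv => Yi | GZ => Z end.

Fixpoint eval (e : expr F uq_gen) : V -> V :=
  match e with
  | EGen g => gen_op g
  | EConst k => fun v => k *: v
  | EAdd a b => fun v => eval a v + eval b v
  | EOpp a => fun v => - eval a v
  | EMul a b => fun v => eval a (eval b v)
  end.

Lemma eval_linear e : linear (eval e).
Proof.
elim: e => [g|k|a IHa b IHb|a IHa|a IHa b IHb] c u v /=.
- by rewrite linearP.
- by rewrite scalerDr !scalerA mulrC.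
- by rewrite IHa IHb scalerDr addrACA.
- by rewrite IHa opprD scalerN.
- by rewrite IHb IHa.
Qed.

Lemma evalD e u v : eval e (u + v) = eval e u + eval e v.
Proof. by rewrite -[u in LHS]scale1r eval_linear scale1r. Qed.

Lemma evalZ e k v : eval e (k *: v) = k *: eval e v.
Proof.
have ev0 : eval e 0 = 0.
  by have := eval_linear e (-1) 0 0; rewrite scaler0 addr0 scaleN1r addNr.
by rewrite -[k *: v in LHS]addr0 eval_linear ev0 addr0.
Qed.

Hypothesis YYi : forall v, Y (Yi v) = v.
Hypothesis YiY : forall v, Yi (Y v) = v.
Hypothesis XY :
  forall v, (q - q^-1)^-1 *: (q *: X (Y v) - q^-1 *: Y (X v)) = v.
Hypothesis YZ :
  forall v, (q - q^-1)^-1 *: (q *: Y (Z v) - q^-1 *: Z (Y v)) = v.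
Hypothesis ZX :
  forall v, (q - q^-1)^-1 *: (q *: Z (X v) - q^-1 *: X (Z v)) = v.

Lemma eval_pcong a b : pcong (@uq_rel F q) a b -> forall v, eval a v = eval b v.
Proof.
elim=> {a b} /=.
- by [].
- by move=> a b _ IH v.
- by move=> a b c _ IH1 _ IH2 v; rewrite IH1.
- by move=> a a' b b' _ IH1 _ IH2 v; rewrite IH1 IH2.
- by move=> a a' _ IH v; rewrite IH.
- by move=> a a' b b' _ IH1 _ IH2 v; rewrite IH2 IH1.
- by move=> *; rewrite addrA.
- by move=> *; rewrite addrC.
- by move=> a v; rewrite scale0r add0r.
- by move=> a v; rewrite addNr scale0r.
- by [].
- by move=> a v; rewrite scale1r.
- by [].
- by move=> a b c v; rewrite evalD.
- by move=> k l v; rewrite scalerDl.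
- by move=> k l v; rewrite scalerA.
- by move=> k a v; rewrite evalZ.
- by move=> a b [] v /=; rewrite ?scale1r.
Qed.

(** The universal property of the presentation: operators satisfying the
defining relations give a module structure. *)
Lemma Uq_module_exists : exists act : Uq q -> V -> V,
  [/\ is_Uq_module act, act (Ux q) =1 X, act (Uy q) =1 Y & act (Uz q) =1 Z].
Proof.
pose act (a : Uq q) v := eval (repr (a : palg (@uq_rel F q))) v.
have actE e v : act (pclass (@uq_rel F q) e) v = eval e v.
  by apply: eval_pcong; exact: repr_pclass.
exists act; split; try by move=> v; rewrite /act; exact: actE.
split.
- by move=> a v w; exact: evalD.
- by move=> a k v; exact: evalZ.
- by move=> a b v; exact: (actE (EAdd _ _)).
- move=> k a v; rewrite [LHS](actE (EMul _ _)) /=.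
  exact: (actE (EConst _ k)).
- by move=> v; rewrite [LHS](actE (EConst _ 1)) /= scale1r.
- by move=> a b v; exact: (actE (EMul _ _)).
Qed.

End Evaluation.

Lemma Uq_module_linear (act : Uq q -> V -> V) a :
  is_Uq_module act -> linear (act a).
Proof. by move=> mact k u v; rewrite (uqmodDr mact) (uqmodZr mact). Qed.

(** A module structure is determined by [x], [y], [z] alone, because the action
of the inverse of [y] is forced. *)
Lemma Uq_module_eq (act act' : Uq q -> V -> V) :
  is_Uq_module act -> is_Uq_module act' ->
  act' (Ux q) =1 act (Ux q) -> act' (Uy q) =1 act (Uy q) ->
  act' (Uz q) =1 act (Uz q) -> act' =2 act.
Proof.
move=> m m' eqx eqy eqz.
have eqyi : act' (Uyinv q) =1 act (Uyinv q).
  move=> v; rewrite -[LHS](uqmod1 m) -Uq_yinvy (uqmodM m) -eqy -(uqmodM m').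
  by rewrite Uq_yyinv (uqmod1 m').
have const k v : act' (pclass _ (EConst _ k)) v = act (pclass _ (EConst _ k)) v.
  have -> : pclass _ (EConst _ k) = k *: (1 : Uq q).
    exact: esym (mulr1 (pclass _ (EConst _ k) : Uq q)).
  by rewrite (uqmodZl m) (uqmodZl m') (uqmod1 m) (uqmod1 m').
apply: palg_ind; elim=> [[]|k|a IHa b IHb|a IHa|a IHa b IHb] v //.
- rewrite -palg_addE -[palg_add _ _]/(_ + _ : Uq q).
  by rewrite (uqmodDl m) (uqmodDl m') IHa IHb.
- rewrite -palg_oppE -[palg_opp _]/(- _ : Uq q) -scaleN1r.
  by rewrite (uqmodZl m) (uqmodZl m') IHa.
- rewrite -palg_mulE -[palg_mul _ _]/(_ * _ : Uq q).
  by rewrite (uqmodM m) (uqmodM m') IHa IHb.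
Qed.

End Modules.

(** * Linear maps given on a basis *)

Section Bases.
Variables (F : fieldType) (V : vectType F).

(** Turns an identity between vectors into one between scalars, in the reach of
[field] once the functional [f] is pushed to the leaves. *)
Lemma eq_by_coordinates (v w : V) :
  (forall f : {scalar V}, f v = f w) -> v = w.
Proof.
move=> eqf; rewrite (coord_vbasis (memvf v)) (coord_vbasis (memvf w)).
by apply: eq_bigr => i _; rewrite (eqf (coord (vbasis fullv) i)).
Qed.

Variables (n : nat) (e : 'I_n -> V).
Hypothesis e_basis : basis_of fullv (mktuple e).

Lemma basis_expansion v : exists k : 'I_n -> F, v = \sum_i k i *: e i.
Proof.
exists (fun i => coord (mktuple e) i v).
rewrite {1}(coord_basis e_basis (memvf v)).
by apply: eq_bigr => i _; rewrite -tnth_nth tnth_mktuple.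
Qed.

Lemma basis_coef0 (k : 'I_n -> F) : \sum_i k i *: e i = 0 -> forall i, k i = 0.
Proof.
move=> k0; have /freeP indep := basis_free e_basis; apply: indep.
by rewrite -[RHS]k0; apply: eq_bigr => i _; rewrite -tnth_nth tnth_mktuple.
Qed.

Lemma linear_eq_on_basis (f g : V -> V) :
  linear f -> linear g -> (forall i, f (e i) = g (e i)) -> f =1 g.
Proof.
have lin0 (h : V -> V) : linear h -> h 0 = 0.
  by move=> /(_ (-1) 0 0); rewrite scaler0 addr0 scaleN1r addNr.
move=> linf ling eqfg v; have [k ->] := basis_expansion v.
elim/big_rec: _ => [|i w _ eqw]; first by rewrite !lin0.
by rewrite linf ling eqfg eqw.
Qed.

Lemma endo_with_values (w : 'I_n -> V) :
  exists f : 'End(V), forall i, f (e i) = w i.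
Proof.
pose f v := \sum_i coord (mktuple e) i v *: w i.
have linf : linear f.
  move=> k u v; rewrite /f scaler_sumr -big_split; apply: eq_bigr => i _.
  by rewrite linearP scalerDl scalerA.
pose f' : {linear V -> V} :=
  HB.pack f (GRing.isLinear.Build F V V *:%R f linf).
exists (linfun f') => i; rewrite lfunE /= /f.
have ei : e i = (mktuple e)`_i by rewrite -tnth_nth tnth_mktuple.
rewrite (bigD1 i) //= big1 => [|j ji].
  by rewrite {1}ei coord_free ?(basis_free e_basis) // eqxx scale1r addr0.
by rewrite ei coord_free ?(basis_free e_basis) // eq_sym (negPf ji) scale0r.
Qed.

End Bases.

Lemma endo_with_values_leq (F : fieldType) (V : vectType F) n (e w : nat -> V) :
  basis_of fullv (mktuple (fun i : 'I_n.+1 => e i)) ->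
  exists f : 'End(V), forall s, (s <= n)%N -> f (e s) = w s.
Proof.
move=> e_basis; have [f fe] := endo_with_values e_basis (fun i => w i).
by exists f => s sn; exact: (fe (Ordinal (sn : (s < n.+1)%N))).
Qed.

(** * Locations and black cliques *)

Section Locations.
Variable N : nat.

Lemma coords_inj : injective (@coords N).
Proof.
move=> [[[a b] c] h] [[[a' b'] c'] h']; rewrite /Defs.coords /= => -[ha hb hc].
by apply: val_inj => /=; congr (_, _, _); apply: val_inj.
Qed.

Lemma coordE eta (l : Delta N) : Defs.coord eta l =
  nth 0%N [:: (coords l).1.1; (coords l).1.2; (coords l).2] eta.
Proof. by rewrite /Defs.coord; case: (coords l) => [[]]. Qed.

Lemma black_cliqueP r s t (l m n : Delta N) : (r + s + t).+1 = N ->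
  coords l = (r.+1, s, t) -> coords m = (r, s.+1, t) ->
  coords n = (r, s, t.+1) -> black_clique [set l; m; n].
Proof.
move=> h hl hm hn; exists r, s, t; split=> //; apply/setP => p.
by rewrite !inE -hl -hm -hn !(inj_eq coords_inj) orbA.
Qed.

(** Two locations of a black 3-clique determine it, so the third location that
[Btilde] quantifies over is the expected one. *)
Lemma black_clique_unique (C C' : {set Delta N}) l m :
  black_clique C -> black_clique C' -> l != m ->
  l \in C -> m \in C -> l \in C' -> m \in C' -> C = C'.
Proof.
move=> [r [s [t [_ ->]]]] [r' [s' [t' [_ ->]]]].
rewrite -(inj_eq coords_inj) !inE => lm lC mC lC' mC'.
suff [-> [-> ->]] : r = r' /\ s = s' /\ t = t' by [].
move: lm lC mC lC' mC'; case: (coords l) => [[a b] c].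
case: (coords m) => [[a' b'] c']; rewrite !xpair_eqE.
lia.
Qed.

Lemma black_clique_third (l m n n' : Delta N) :
  black_clique [set l; m; n] -> black_clique [set l; m; n'] ->
  l != m -> n != l -> n != m -> n' = n.
Proof.
move=> bC bC' lm nl nm.
have eqC : [set l; m; n] = [set l; m; n'].
  by apply: (black_clique_unique bC bC' lm); rewrite !inE eqxx ?orbT.
have : n \in [set l; m; n'] by rewrite -eqC !inE eqxx orbT.
by rewrite !inE (negPf nl) (negPf nm) => /eqP.
Qed.

Lemma black_clique_collinear (C : {set Delta N}) l m :
  black_clique C -> l \in C -> m \in C ->
  exists eta, Defs.coord eta l = Defs.coord eta m.
Proof.
move=> [r [s [t [_ ->]]]]; rewrite !inE.
by case/or3P => /eqP El; case/or3P => /eqP Em;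
  [exists 1 | exists 2%:R | exists 1 | exists 2%:R | exists 0 | exists 0
  | exists 1 | exists 0 | exists 0]; rewrite !coordE El Em.
Qed.

Lemma coord_le eta (l : Delta N) : (Defs.coord eta l <= N)%N.
Proof.
case: l => [[[r s] t] h]; rewrite coordE /=.
by move: h => /= /eqP h; case: eta => [[|[|[|//]]] ?] /=; lia.
Qed.

End Locations.

(** * Entries of a Billiard Array *)

Section Arrays.
Variables (F : fieldType) (V : vectType F) (N : nat).
Variable B : Delta N -> {vspace V}.
Hypothesis arrB : billiard_array B.

Lemma nonzero_spans l u v :
  u \in B l -> u != 0 -> v \in B l -> exists k, v = k *: u.
Proof.
move=> Bu u0 Bv; suff : v \in <[u]>%VS by move/vlineP.
suff -> : <[u]>%VS = B l by [].
by apply/eqP; rewrite eqEdim -memvE Bu (billiard_dim1 arrB) dim_vline u0.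
Qed.

Lemma collinear_disjoint eta l m :
  Defs.coord eta l = Defs.coord eta m -> l != m ->
  (B l :&: B m = 0)%VS.
Proof.
move=> eqlm lm.
pose L := [set p : Delta N | Defs.coord eta p == Defs.coord eta l].
have /(billiard_line arrB)/directv_sumP dL : is_line L.
  by exists eta, (Defs.coord eta l); split=> //; exact: coord_le.
apply/eqP; rewrite -subv0 -(dL l) ?inE //; apply: capvS => //.
by apply: (sumv_sup m); rewrite // inE eqlm eqxx eq_sym.
Qed.

Lemma clique_disjoint C l m u : black_clique C -> l \in C -> m \in C ->
  l != m -> u \in B l -> u \in B m -> u = 0.
Proof.
move=> bC lC mC lm ul um.
have [eta eqlm] := black_clique_collinear bC lC mC.
by apply/eqP; rewrite -memv0 -(collinear_disjoint eqlm lm) memv_cap ul um.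
Qed.

(** The sum over the clique is not direct although its three lines are pairwise
independent, so each of them lies in the plane spanned by the other two. *)
Lemma black_completion l m n u :
  black_clique [set l; m; n] -> l != m -> n != l -> n != m -> u \in B l ->
  exists2 v, v \in B m & u + v \in B n.
Proof.
move=> bC lm nl nm ul.
have dmn : (B m :&: B n = 0)%VS.
  have [eta eqmn] : exists eta, Defs.coord eta m = Defs.coord eta n.
    by apply: (black_clique_collinear bC); rewrite !inE eqxx ?orbT.
  by apply: (collinear_disjoint eqmn); rewrite eq_sym.
suff : u \in (B m + B n)%VS.
  case/memv_addP => v vm [w wn def_u]; exists (- v); first by rewrite memvN.
  by rewrite def_u addrC addKr.
rewrite memvE; apply/negPn/negP => nsub.
have /eqP u0 : u != 0 by apply: contraNneq nsub => ->; rewrite -memvE mem0v.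
have /negP := billiard_black arrB bC; apply; rewrite directvE /=.
have nin : l \notin [set m; n].
  by rewrite !inE negb_or lm eq_sym.
have min : m \notin [set n] by rewrite inE eq_sym.
rewrite -setUA !(big_setU1 _ nin) !(big_setU1 _ min) /=.
rewrite !big_set1 !(billiard_dim1 arrB).
rewrite dimv_disjoint_sum.
  by rewrite dimv_disjoint_sum // !(billiard_dim1 arrB).
apply/eqP; rewrite -subv0; apply/subvP => w; rewrite memv_cap => /andP[wl wmn].
rewrite memv0; apply/negPn/negP => w0.
have [k def_u] := nonzero_spans wl w0 ul.
by case/negP: nsub; rewrite -memvE def_u memvZ.
Qed.

Lemma BtildeP l m n u :
  black_clique [set l; m; n] -> l != m -> n != l -> n != m ->
  u \in B l -> u != 0 ->
  [/\ Btilde B l m u \in B m, Btilde B l m u != 0 & u + Btilde B l m u \in B n].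
Proof.
move=> bC lm nl nm ul u0.
have [v vm uvn] := black_completion bC lm nl nm ul.
have v0 : v != 0.
  apply: contraNneq u0 => v0; move: uvn; rewrite v0 addr0 => un.
  by apply/eqP/(clique_disjoint bC _ _ _ ul un);
    rewrite ?inE ?eqxx ?orbT // eq_sym.
have /(classical_sets.xgetPex 0)[Bm B0 [n' [bC' Bn]]] :
  exists v, [/\ v \in B m, v != 0 &
    exists n : Delta N, black_clique [set l; m; n] /\ u + v \in B n].
  by exists v; split=> //; exists n.
split=> //; by rewrite (black_clique_third bC bC' lm nl nm) in Bn.
Qed.

(** The entries along an edge are [N.+1] independent lines in a space of
dimension [N.+1]. *)
Lemma edge_basis (f : 'I_N.+1 -> Delta N) eta (e : 'I_N.+1 -> V) :
  \dim {:V} = N.+1 -> injective f -> (forall i, Defs.coord eta (f i) = 0%N) ->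
  (forall i, e i \in B (f i)) -> (forall i, e i != 0) ->
  basis_of fullv (mktuple e).
Proof.
move=> dimV injf f0 eB e0.
have lineL : is_line [set l : Delta N | Defs.coord eta l == 0%N].
  by exists eta, 0%N.
have /directv_sum_independent indep := billiard_line arrB lineL.
rewrite basisEfree subvf size_tuple dimV leqnn !andbT.
apply/freeP => k k0 i.
pose us l := \sum_(j | f j == l) k j *: e j.
have us0 : us (f i) = 0.
  apply: indep; last by rewrite inE f0.
    by move=> l _; apply: memv_suml => j /eqP <-; rewrite memvZ.
  rewrite -[RHS]k0.
  rewrite (partition_big f (fun l => Defs.coord eta l == 0%N)); last first.
    by move=> j _; rewrite f0.
  apply: eq_big => [l|l _]; first by rewrite inE.
  by apply: eq_bigr => j _; rewrite -tnth_nth tnth_mktuple.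
move: us0; rewrite /us (eq_bigl (pred1 i)) ?big_pred1_eq.
  by move/eqP; rewrite scaler_eq0 (negPf (e0 i)) orbF => /eqP.
by move=> j /=; rewrite (inj_eq injf).
Qed.

(** Indexing by plain triples avoids carrying proofs that the coordinates sum to
[N]; outside [Delta N] the entry is the zero space. *)
Definition entry (r s t : nat) : {vspace V} :=
  (\sum_(l | coords l == (r, s, t)) B l)%VS.

Lemma entryE l r s t : coords l = (r, s, t) -> entry r s t = B l.
Proof.
move=> hl; rewrite /entry (eq_bigl (pred1 l)) ?big_pred1_eq // => m.
by rewrite -hl (inj_eq (@coords_inj N)).
Qed.

Lemma entry_loc r s t (h : (r + s + t = N)%N) : entry r s t = B (loc h).
Proof. exact: entryE (coords_loc h). Qed.

Lemma entry_neq0 r s t : (r + s + t = N)%N ->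
  exists2 u, u \in entry r s t & u != 0.
Proof.
move=> h; exists (vpick (B (loc h))); first by rewrite (entry_loc h) memv_pick.
by rewrite vpick0 -dimv_eq0 (billiard_dim1 arrB).
Qed.

Lemma adjacent_disjoint r s t u : (r + s + t).+1 = N ->
  u \in entry r.+1 s t -> u \in entry r s.+1 t -> u = 0.
Proof.
move=> h.
have h1 : (r.+1 + s + t = N)%N by lia.
have h2 : (r + s.+1 + t = N)%N by lia.
rewrite (entry_loc h1) (entry_loc h2) => u1 u2.
apply/eqP; rewrite -memv0 -(@collinear_disjoint 2%:R (loc h1) (loc h2)).
- by rewrite memv_cap u1.
- by rewrite !coordE.
- by rewrite -(inj_eq (@coords_inj N)) !coords_loc !xpair_eqE; lia.
Qed.

Lemma edge_step r s t u : (r + s + t).+1 = N ->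
  u \in entry r.+1 s t -> u != 0 ->
  exists v, [/\ v \in entry r s.+1 t, v != 0 & u - v \in entry r s t.+1].
Proof.
move=> h.
have h1 : (r.+1 + s + t = N)%N by lia.
have h2 : (r + s.+1 + t = N)%N by lia.
have h3 : (r + s + t.+1 = N)%N by lia.
have bC := black_cliqueP h (coords_loc h1) (coords_loc h2) (coords_loc h3).
rewrite (entry_loc h1) (entry_loc h2) (entry_loc h3) => uB u0.
have neq (a b : Delta N) : coords a != coords b -> a != b.
  by rewrite (inj_eq (@coords_inj N)).
have [v2 v0 v3] : [/\ Btilde B (loc h1) (loc h2) u \in B (loc h2),
    Btilde B (loc h1) (loc h2) u != 0
    & u + Btilde B (loc h1) (loc h2) u \in B (loc h3)].
  by apply: (BtildeP bC) => //; apply: neq; rewrite !coords_loc !xpair_eqE; lia.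
exists (- Btilde B (loc h1) (loc h2) u).
by rewrite memvN oppr_eq0 opprK.
Qed.

(** Each vector of the edge [t = 0] determines the next one: the two must differ
by a vector of row 1. *)
Lemma edge_family : exists e : nat -> V,
  (forall s, (s <= N)%N -> e s \in entry (N - s) s 0 /\ e s != 0) /\
  (forall s, (s < N)%N -> e s - e s.+1 \in entry (N - s.+1) s 1).
Proof.
have next (su : nat * V) : exists v, (su.1 < N)%N ->
    su.2 \in entry (N - su.1) su.1 0 -> su.2 != 0 ->
    [/\ v \in entry (N - su.1.+1) su.1.+1 0, v != 0
      & su.2 - v \in entry (N - su.1.+1) su.1 1].
  case: su => s u /=; case: (ltnP s N) => sN; last by exists 0.
  have [uB|] := boolP (u \in entry (N - s) s 0); last by exists 0.
  have [->|u0] := eqVneq u 0; first by exists 0.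
  have eqr : (N - s = (N - s.+1).+1)%N by lia.
  have h : (N - s.+1 + s + 0).+1 = N by lia.
  rewrite eqr in uB; have [v vP] := edge_step h uB u0.
  by exists v.
have [f fP] := choice next.
have [u uB u0] := entry_neq0 (etrans (addn0 _) (addn0 N)).
pose e := nat_rect (fun _ => V) u (fun s v => f (s, v)).
have eP s : (s <= N)%N -> e s \in entry (N - s) s 0 /\ e s != 0.
  elim: s => [|s IHs] sN; first by rewrite subn0.
  have [eB e0] := IHs (ltnW sN).
  by have [] := fP (s, e s) sN eB e0.
exists e; split=> // s sN; have [eB e0] := eP s (ltnW sN).
by have [] := fP (s, e s) sN eB e0.
Qed.

(** Start from [e1 - e2] and go round the white 3-clique: [e1 - e2] is completed
by some [b] to a vector of the entry [(r, s, t.+2)], then [b] by some [c] to a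
vector of [(r.+2, s, t)], then [c] by [q ^- 2 *: (e1 - e2)] to a vector of
[(r, s.+2, t)], which is where the hypothesis on the values enters.  Completions
being unique, the last step forces [c = - q ^- 2 *: e1], then the second one
forces [b = - q ^- 2 *: (e0 - e1)], and the first one says that the stated
combination, up to a factor, lies in [(r, s, t.+2)]. *)
Lemma white_step (q : F) r s t e0 e1 e2 : q != 0 ->
  (forall l m n : Delta N, white_clique l m n -> has_Bvalue B l m n (q ^- 2)) ->
  (r + s + t).+2 = N ->
  e0 \in entry r.+2 s t -> e1 \in entry r.+1 s.+1 t -> e2 \in entry r s.+2 t ->
  e1 != 0 ->
  e0 - e1 \in entry r.+1 s t.+1 -> e1 - e2 \in entry r s.+1 t.+1 ->
  (e0 - e1) - q ^+ 2 *: (e1 - e2) \in entry r s t.+2.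
Proof.
move=> q0 Bval h.
have hl : (r + s.+1 + t.+1 = N)%N by lia.
have hm : (r.+1 + s + t.+1 = N)%N by lia.
have hn : (r.+1 + s.+1 + t = N)%N by lia.
have h0 : (r.+2 + s + t = N)%N by lia.
have h2 : (r + s.+2 + t = N)%N by lia.
have h3 : (r + s + t.+2 = N)%N by lia.
set l := loc hl; set m := loc hm; set n := loc hn.
pose l0 := loc h0; pose l2 := loc h2; pose l3 := loc h3.
have neq (a b : Delta N) : coords a != coords b -> a != b.
  by rewrite (inj_eq (@coords_inj N)).
have clm : black_clique [set l; m; l3].
  rewrite [ [set l; m] ]setUC.
  by apply: (@black_cliqueP N r s t.+1) => //; lia.
have cmn : black_clique [set m; n; l0].
  rewrite [ [set m; n] ]setUC setUC setUA.
  by apply: (@black_cliqueP N r.+1 s t) => //; lia.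
have cnl : black_clique [set n; l; l2].
  rewrite -setUA [ [set l; l2] ]setUC setUA.
  by apply: (@black_cliqueP N r s.+1 t) => //; lia.
rewrite (entry_loc hl) (entry_loc hm) (entry_loc hn) (entry_loc h0).
rewrite (entry_loc h2) (entry_loc h3) -/l -/m -/n -/l0 -/l2 -/l3.
move=> e0B e1B e2B e1n0 e01 e12.
have [n_lm n_l3l n_l3m] : [/\ l != m, l3 != l & l3 != m].
  by split; apply: neq; rewrite !coords_loc !xpair_eqE; lia.
have [n_mn n_l0m n_l0n] : [/\ m != n, l0 != m & l0 != n].
  by split; apply: neq; rewrite !coords_loc !xpair_eqE; lia.
have [n_nl n_l2n n_l2l] : [/\ n != l, l2 != n & l2 != l].
  by split; apply: neq; rewrite !coords_loc !xpair_eqE; lia.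
have e12n0 : e1 - e2 != 0.
  rewrite subr_eq0; apply: contraNneq e1n0 => e1_e2; apply/eqP.
  by apply: (clique_disjoint cnl (l := n) (m := l2)) => //;
    rewrite ?inE ?eqxx ?orbT 1?eq_sym // {1}e1_e2.
have [bm b0 b3] := BtildeP clm n_lm n_l3l n_l3m e12 e12n0.
set b := Btilde B l m (e1 - e2) in bm b0 b3.
have [cn c0 c3] := BtildeP cmn n_mn n_l0m n_l0n bm b0.
set c := Btilde B m n b in cn c0 c3.
have [al a0 a3] := BtildeP cnl n_nl n_l2n n_l2l cn c0.
have wC : white_clique l m n by exists r, s, t.
rewrite (Bval _ _ _ wC _ e12) in a3.
have def_c : c = - q ^- 2 *: e1.
  apply/eqP; rewrite -subr_eq0; apply/eqP.
  apply: (clique_disjoint cnl (l := n) (m := l2)).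
  - by rewrite !inE eqxx.
  - by rewrite !inE eqxx orbT.
  - by rewrite eq_sym.
  - by rewrite memvB // memvZ.
  - rewrite scaleNr opprK.
    have -> : c + q ^- 2 *: e1 = (c + q ^- 2 *: (e1 - e2)) + q ^- 2 *: e2.
      by rewrite scalerBr addrA subrK.
    by rewrite memvD // memvZ.
have def_b : b = - q ^- 2 *: (e0 - e1).
  apply/eqP; rewrite -subr_eq0; apply/eqP.
  apply: (clique_disjoint cmn (l := m) (m := l0)).
  - by rewrite !inE eqxx.
  - by rewrite !inE eqxx orbT.
  - by rewrite eq_sym.
  - by rewrite memvB // memvZ.
  - have -> : b - - q ^- 2 *: (e0 - e1) = (b + c) + q ^- 2 *: e0.
      by rewrite def_c scaleNr opprK scalerBr scaleNr addrA addrAC.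
    by rewrite memvD // memvZ.
have -> : e0 - e1 - q ^+ 2 *: (e1 - e2) = - q ^+ 2 *: (e1 - e2 + b).
  rewrite def_b [in RHS]scalerDr [in RHS]scalerA mulrNN.
  rewrite divff ?expf_neq0 // scale1r.
  by rewrite addrC scaleNr.
by rewrite memvZ.
Qed.

End Arrays.

(** * A normalized vector in each entry *)

Section Family.
Variables (F : fieldType) (q : F) (V : vectType F) (N : nat).
Hypothesis q0 : q != 0.

(** The factor [q ^ (2 s)] is the one that [white_step] needs: the quotient of
two consecutive factors is [q ^ 2]. *)
Fixpoint row_family (e : nat -> V) (t s : nat) : V :=
  if t is t'.+1
  then q ^+ s ^+ 2 *: (row_family e t' s - row_family e t' s.+1)
  else e s.

Section Adapted.
Variable B : Delta N -> {vspace V}.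
Hypothesis arrB : billiard_array B.
Hypothesis Bval :
  forall l m n : Delta N, white_clique l m n -> has_Bvalue B l m n (q ^- 2).

(** By induction on the row [t], together with the fact that consecutive
differences in row [t] lie in row [t.+1]. *)
Lemma row_family_entry e :
  (forall s, (s <= N)%N -> e s \in entry B (N - s) s 0 /\ e s != 0) ->
  (forall s, (s < N)%N -> e s - e s.+1 \in entry B (N - s.+1) s 1) ->
  forall t s, (s + t <= N)%N ->
  row_family e t s \in entry B (N - (s + t)) s t /\ row_family e t s != 0.
Proof.
move=> eP eD t.
suff: (forall s, (s + t <= N)%N ->
    row_family e t s \in entry B (N - (s + t)) s t /\ row_family e t s != 0) /\
  (forall s, (s + t < N)%N ->
    row_family e t s - row_family e t s.+1 \in entry B (N - (s + t.+1)) s t.+1).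
  by case.
elim: t => [|t [IHb IHd]].
  by split=> s; rewrite addn0 ?addn1 => sN; [apply: eP | apply: eD].
set b := row_family e t in IHb IHd *.
split=> s stN /=; rewrite -/b.
  have [bB bn0] := IHb s ltac:(lia).
  have [bB' _] := IHb s.+1 ltac:(lia).
  split; first by rewrite memvZ // IHd //; lia.
  rewrite scaler_eq0 !expf_eq0 (negPf q0) !andbF /= subr_eq0.
  apply: contraNneq bn0 => eqb; apply/eqP.
  apply: (@adjacent_disjoint _ _ _ _ arrB (N - (s + t.+1)) s t); first lia.
    by rewrite -subSn ?addnS // in bB *; lia.
  by rewrite eqb -addSnnS.
have E2 : (N - (s + t) = (N - (s + t.+2)).+2)%N by lia.
have E1 : (N - (s.+1 + t) = (N - (s + t.+2)).+1)%N by lia.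
have E0 : (N - (s.+2 + t) = N - (s + t.+2))%N by lia.
have E1' : (N - (s + t.+1) = (N - (s + t.+2)).+1)%N by lia.
have E0' : (N - (s.+1 + t.+1) = N - (s + t.+2))%N by lia.
have [B0 _] := IHb s ltac:(lia); have [B1 n1] := IHb s.+1 ltac:(lia).
have [B2 _] := IHb s.+2 ltac:(lia).
have D0 := IHd s ltac:(lia); have D1 := IHd s.+1 ltac:(lia).
rewrite E2 in B0; rewrite E1 in B1; rewrite E0 in B2.
rewrite E1' in D0; rewrite E0' in D1.
have h : (N - (s + t.+2) + s + t).+2 = N by lia.
have := white_step arrB q0 Bval h B0 B1 B2 n1 D0 D1.
have -> : q ^+ s.+1 ^+ 2 = q ^+ s ^+ 2 * q ^+ 2.
  by rewrite (exprS q s) exprMn mulrC.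
by rewrite -scalerA -scalerBr => ?; rewrite memvZ.
Qed.

End Adapted.

Section Operators.
Variable e : nat -> V.
Let b := row_family e.
Let C := q ^+ N.

(** The coefficient of [b t s.+1] vanishes when [s + t = N]. *)
Lemma raising_row (X : 'End(V)) :
  (forall s, (s <= N)%N ->
     X (e s) = (q ^+ s ^+ 2 / C) *: e s + (C - q ^+ s ^+ 2 / C) *: e s.+1) ->
  forall t s, (s + t <= N)%N ->
  X (b t s) = (q ^+ s ^+ 2 / C) *: b t s
              + (C / q ^+ t ^+ 2 - q ^+ s ^+ 2 / C) *: b t s.+1.
Proof.
move=> Xe; elim=> [|t IHt] s stN.
  by rewrite Xe ?expr0 ?expr1n ?divr1 // -(addn0 s).
rewrite /b /= -/(row_family e) -/b.
rewrite linearZ linearB /= !IHt; try lia.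
have C0 : C != 0 by rewrite expf_neq0.
have T0 : q ^+ t != 0 by rewrite expf_neq0.
apply: eq_by_coordinates => f; rewrite !(linearD, linearB, linearN, linearZ) /=.
rewrite !exprS; move: (q ^+ s) (q ^+ t) C C0 T0 => a u c c0 u0.
by field; rewrite q0 c0 u0.
Qed.

(** The coefficient of [b t s.-1] vanishes when [s = 0], where [s.-1] is not the
index of a predecessor. *)
Lemma lowering_row (Y : 'End(V)) :
  (forall s, (s <= N)%N ->
     Y (e s) = (q ^+ s ^+ 2 / C) *: e s + ((1 - q ^+ s ^+ 2) / C) *: e s.-1) ->
  forall t s, (s + t <= N)%N ->
  Y (b t s) = (q ^+ s ^+ 2 * q ^+ t ^+ 2 / C) *: b t s
              + (q ^+ t ^+ 2 * (1 - q ^+ s ^+ 2) / C) *: b t s.-1.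
Proof.
move=> Ye; have C0 : C != 0 by rewrite expf_neq0.
elim=> [|t IHt] s stN.
  by rewrite Ye ?expr0 ?expr1n ?mulr1 ?mul1r // -(addn0 s).
rewrite /b /= -/(row_family e) -/b.
rewrite linearZ linearB /= !IHt; try lia.
apply: eq_by_coordinates => f; rewrite !(linearD, linearB, linearN, linearZ) /=.
case: s stN => [|s] stN /=; rewrite ?expr0 !exprS.
  by move: (q ^+ t) C C0 => u c c0; field; rewrite c0.
by move: (q ^+ s) (q ^+ t) C C0 => a u c c0; field; rewrite c0.
Qed.

End Operators.
End Family.

(** * The operators on the basis, their relations, and irreducibility *)

Section Model.
Variables (F : fieldType) (q : F) (V : vectType F) (N : nat) (e : nat -> V).
Hypothesis q0 : q != 0.
Hypothesis e_basis : basis_of fullv (mktuple (fun i : 'I_N.+1 => e i)).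
Variables X Y Z : 'End(V).
Let C := q ^+ N.
Hypothesis Xe : forall s, (s <= N)%N ->
  X (e s) = (q ^+ s ^+ 2 / C) *: e s + (C - q ^+ s ^+ 2 / C) *: e s.+1.
Hypothesis Ye : forall s, (s <= N)%N ->
  Y (e s) = (q ^+ s ^+ 2 / C) *: e s + ((1 - q ^+ s ^+ 2) / C) *: e s.-1.
Hypothesis Ze : forall s, (s <= N)%N -> Z (e s) = (C / q ^+ s ^+ 2) *: e s.

Let C0 : C != 0. Proof. exact: expf_neq0. Qed.

Let scale_end (f : 'End(V)) k u : f (k *: u) = k *: f u.
Proof. by rewrite linearZ. Qed.

Section Relations.
Hypothesis q21 : q ^+ 2 != 1.

Lemma qVq_neq0 : q - q^-1 != 0.
Proof.
rewrite subr_eq0; apply: contraNneq q21 => qV.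
by rewrite expr2 {2}qV divff.
Qed.

Let eq_on_basis (f g : 'End(V)) :
  (forall s, (s <= N)%N -> f (e s) = g (e s)) -> f =1 g.
Proof.
move=> eqfg; apply: (linear_eq_on_basis e_basis) => [||i]; try exact: linearP.
by apply: eqfg; rewrite -ltnS.
Qed.

Let qcommutator (f g : 'End(V)) : 'End(V) :=
  (q - q^-1)^-1 *: (q *: (f \o g) - q^-1 *: (g \o f))%VF.

Let qcommutatorE f g v : qcommutator f g v =
  (q - q^-1)^-1 *: (q *: f (g v) - q^-1 *: g (f v)).
Proof. by rewrite !lfunE /= !lfunE /= !lfunE /= !lfunE /= !lfunE. Qed.

Let qcommutator1 (f g : 'End(V)) :
  (forall s, (s <= N)%N ->
    q *: f (g (e s)) - q^-1 *: g (f (e s)) = (q - q^-1) *: e s) ->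
  forall v, (q - q^-1)^-1 *: (q *: f (g v) - q^-1 *: g (f v)) = v.
Proof.
move=> fg v; rewrite -qcommutatorE -[RHS]id_lfunE; move: v; apply: eq_on_basis.
move=> s sN; rewrite qcommutatorE fg // scalerA mulVf ?qVq_neq0 //.
by rewrite scale1r id_lfunE.
Qed.

(* The next four formulas hold without restriction at the ends of the edge: at
   [s = 0] and at [s = N], where the neighbouring location does not exist, the
   scalar in front vanishes. *)
Let X_pred s : (s <= N)%N -> ((1 - q ^+ s ^+ 2) / C) *: X (e s.-1) =
  ((1 - q ^+ s ^+ 2) / C) *: ((q ^+ s ^+ 2 / q ^+ 2 / C) *: e s.-1
     + (C - q ^+ s ^+ 2 / q ^+ 2 / C) *: e s).
Proof.
case: s => [|s] sN; first by rewrite expr0 expr1n subrr mul0r !scale0r.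
rewrite /= Xe; last exact: ltnW.
by rewrite (exprS q s) exprMn [q ^+ 2 * _]mulrC mulfK // expf_neq0.
Qed.

Let Y_succ s : (s <= N)%N -> (C - q ^+ s ^+ 2 / C) *: Y (e s.+1) =
  (C - q ^+ s ^+ 2 / C) *: ((q ^+ 2 * q ^+ s ^+ 2 / C) *: e s.+1
     + ((1 - q ^+ 2 * q ^+ s ^+ 2) / C) *: e s).
Proof.
rewrite leq_eqVlt => /predU1P[->|sN].
  by rewrite -/C expr2 mulfK // subrr !scale0r.
by rewrite Ye //= (exprS q s) exprMn.
Qed.

Let Z_pred s : (s <= N)%N -> ((1 - q ^+ s ^+ 2) / C) *: Z (e s.-1) =
  ((1 - q ^+ s ^+ 2) / C) *: ((q ^+ 2 * C / q ^+ s ^+ 2) *: e s.-1).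
Proof.
case: s => [|s] sN; first by rewrite expr0 expr1n subrr mul0r !scale0r.
rewrite /= Ze; last exact: ltnW.
have s0 : q ^+ s != 0 by rewrite expf_neq0.
rewrite (exprS q s); congr (_ *: (_ *: _)).
by move: (q ^+ s) s0 => a a0; field; rewrite q0 a0.
Qed.

Let Z_succ s : (s <= N)%N -> (C - q ^+ s ^+ 2 / C) *: Z (e s.+1) =
  (C - q ^+ s ^+ 2 / C) *: ((C / q ^+ 2 / q ^+ s ^+ 2) *: e s.+1).
Proof.
rewrite leq_eqVlt => /predU1P[->|sN].
  by rewrite -/C expr2 mulfK // subrr !scale0r.
have s0 : q ^+ s != 0 by rewrite expf_neq0.
rewrite Ze // (exprS q s); congr (_ *: (_ *: _)).
by move: (q ^+ s) s0 => a a0; field; rewrite q0 a0.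
Qed.

Let lincomb (f : 'End(V)) k l u w : f (k *: u + l *: w) = k *: f u + l *: f w.
Proof. by rewrite linearD !linearZ. Qed.

Lemma model_XY v : (q - q^-1)^-1 *: (q *: X (Y v) - q^-1 *: Y (X v)) = v.
Proof.
move: v; apply: qcommutator1 => s sN.
rewrite Xe // Ye // !lincomb X_pred // Y_succ // Xe // Ye //.
apply: eq_by_coordinates => f; rewrite !(linearD, linearB, linearN, linearZ) /=.
by move: (q ^+ s) C C0 => a c c0; field; rewrite q0 c0.
Qed.

Lemma model_YZ v : (q - q^-1)^-1 *: (q *: Y (Z v) - q^-1 *: Z (Y v)) = v.
Proof.
move: v; apply: qcommutator1 => s sN.
have s0 : q ^+ s != 0 by rewrite expf_neq0.
rewrite Ye // Ze // lincomb scale_end Z_pred // Ze // Ye //.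
apply: eq_by_coordinates => f; rewrite !(linearD, linearB, linearN, linearZ) /=.
by move: (q ^+ s) s0 C C0 => a a0 c c0; field; rewrite q0 c0 a0.
Qed.

Lemma model_ZX v : (q - q^-1)^-1 *: (q *: Z (X v) - q^-1 *: X (Z v)) = v.
Proof.
move: v; apply: qcommutator1 => s sN.
have s0 : q ^+ s != 0 by rewrite expf_neq0.
rewrite Xe // Ze // lincomb scale_end Z_succ // Ze // Xe //.
apply: eq_by_coordinates => f; rewrite !(linearD, linearB, linearN, linearZ) /=.
by move: (q ^+ s) s0 C C0 => a a0 c c0; field; rewrite q0 c0 a0.
Qed.

End Relations.

Section Irreducibility.
Hypothesis q_ord : forall i, (1 <= i <= N)%N -> q ^+ (2 * i) != 1.
Variable W : {vspace V}.
Hypotheses (WX : forall w, w \in W -> X w \in W)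
           (WY : forall w, w \in W -> Y w \in W)
           (WZ : forall w, w \in W -> Z w \in W).

Let XZ1 s : (s <= N)%N ->
  X (Z (e s)) - e s = (C ^+ 2 / q ^+ s ^+ 2 - 1) *: e s.+1.
Proof.
move=> sN; have s0 : q ^+ s != 0 by rewrite expf_neq0.
rewrite Ze // scale_end Xe //.
apply: eq_by_coordinates => f; rewrite !(linearD, linearB, linearN, linearZ) /=.
by move: (q ^+ s) s0 C C0 => a a0 c c0; field; rewrite c0 a0.
Qed.

Let YZ1 s : (s <= N)%N ->
  Y (Z (e s)) - e s = ((q ^+ s ^+ 2)^-1 - 1) *: e s.-1.
Proof.
move=> sN; have s0 : q ^+ s != 0 by rewrite expf_neq0.
rewrite Ze // scale_end Ye //.
apply: eq_by_coordinates => f; rewrite !(linearD, linearB, linearN, linearZ) /=.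
by move: (q ^+ s) s0 C C0 => a a0 c c0; field; rewrite c0 a0.
Qed.

(** Applying [X Z - 1] to a nonzero vector of [W] shifts its lowest term one
step up with a nonzero factor; [k] bounds the number of steps needed to reach
the top. *)
Lemma top_in_submodule k (c : nat -> F) : (k <= N)%N ->
  (forall i, (i < N - k)%N -> c i = 0) ->
  \sum_(i < N.+1) c i *: e i \in W -> \sum_(i < N.+1) c i *: e i != 0 ->
  e N \in W.
Proof.
elim: k c => [|k IHk] c kN c_lo.
  rewrite big_ord_recr /= big1 => [|i _]; last first.
    by rewrite c_lo ?subn0 // scale0r.
  rewrite add0r scaler_eq0 negb_or => cW /andP[c0 _].
  by rewrite -[e N]scale1r -(mulVf c0) -scalerA memvZ.
have [ck0|ck0] := eqVneq (c (N - k.+1)%N) 0.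
  apply: IHk => [|i iNk]; first exact: ltnW.
  by have [->//|ni] := eqVneq i (N - k.+1)%N; apply: c_lo; lia.
move=> wW _; set w := \sum_(i < _) _ in wW.
pose rho i := C ^+ 2 / q ^+ i ^+ 2 - 1.
pose c' i := if i is j.+1 then c j * rho j else 0.
(* Both sums have the same length: the top term of [w] is killed as
   [rho N = 0], and the shifted sum has no term in degree 0. *)
have Rw : X (Z w) - w = \sum_(i < N.+1) c' i *: e i.
  transitivity (\sum_(i < N.+1) (X (Z (c i *: e i)) - c i *: e i)).
    by rewrite sumrB /w; congr (_ - _); rewrite !linear_sum.
  rewrite big_ord_recr [RHS]big_ord_recl /= scale0r add0r.
  have -> : X (Z (c N *: e N)) - c N *: e N = 0.
    rewrite !scale_end -scalerBr XZ1 // -/C divff ?expf_neq0 //.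
    by rewrite subrr scale0r scaler0.
  rewrite addr0; apply: eq_bigr => i _; rewrite !scale_end -scalerBr.
  by rewrite XZ1 ?scalerA //= ltnW.
apply: (IHk c'); first exact: ltnW.
- by case=> [|i] // iNk /=; rewrite c_lo ?mul0r //; lia.
- by rewrite -Rw memvB // WX // WZ.
apply/eqP => /(basis_coef0 e_basis) /(_ (inord (N - k.+1).+1)).
rewrite inordK /=; last by lia.
move/eqP; rewrite mulf_eq0 (negPf ck0) /= /rho subr_eq0 => /eqP eq1.
have /q_ord/eqP : (1 <= k.+1 <= N)%N by [].
apply; rewrite mulnC exprM -[RHS]eq1 /C.
have -> : q ^+ N = q ^+ (N - k.+1) * q ^+ k.+1 by rewrite -exprD subnK.
by rewrite exprMn mulrAC divff ?mul1r ?expf_neq0 // exprAC.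
Qed.

Lemma stable_subspace_trivial : W = 0%VS \/ W = fullv.
Proof.
have [->|Wn0] := eqVneq W 0%VS; [by left | right].
have eW k : (k <= N)%N -> e (N - k) \in W.
  elim: k => [_|k IHk kN].
    have [c def_w] := basis_expansion e_basis (vpick W).
    pose c' j := c (inord j).
    have def_w' : \sum_(i < N.+1) c' i *: e i = vpick W.
      by rewrite def_w; apply: eq_bigr => i _; rewrite /c' inord_val.
    rewrite subn0; apply: (@top_in_submodule N c') => //.
    - by move=> i; rewrite subnn.
    - by rewrite def_w' memv_pick.
    - by rewrite def_w' vpick0.
  have := YZ1 (leq_subr k N); set d := (_^-1 - 1) => YZk.
  have d0 : d != 0.
    have /q_ord : (1 <= N - k <= N)%N by lia.
    apply: contraNneq => /eqP; rewrite subr_eq0 mulnC exprM => /eqP d1.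
    by rewrite -[_ ^+ 2]invrK d1 invr1.
  rewrite -[e _]scale1r -(mulVf d0) -scalerA memvZ //.
  have -> : (N - k.+1)%N = (N - k).-1 by lia.
  by rewrite -YZk memvB ?IHk ?WY ?WZ ?IHk // ltnW.
apply/eqP; rewrite eqEsubv subvf /=; apply/subvP => v _.
have [c ->] := basis_expansion e_basis v.
apply: memv_suml => i _; rewrite memvZ //.
by rewrite -[nat_of_ord i](subKn (_ : i <= N)%N) ?eW ?leq_subr // -ltnS.
Qed.

End Irreducibility.
End Model.

Lemma exprz_component (F : fieldType) (q : F) (N i : nat) : q != 0 ->
  q ^ (N%:Z - 2 * i%:Z) = q ^+ N / q ^+ i ^+ 2.
Proof.
by move=> q0; rewrite -PoszM expfzDr // mulnC -exprnN -exprM.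
Qed.

(** * Existence, uniqueness and irreducibility *)

Theorem theorem21p26 (F : fieldType) (q : F) (N : nat) (V : vectType F)
    (B : Delta N -> {vspace V}) :
  q != 0 -> q ^+ 2 != 1 ->
  \dim {:V} = N.+1 ->
  billiard_array B ->
  (forall l m n : Delta N,
     white_clique l m n -> has_Bvalue B l m n (q ^- 2)) ->
  exists act : Uq q -> V -> V,
    [/\ is_Uq_module act /\ vanishing B act,
        forall act' : Uq q -> V -> V,
          is_Uq_module act' -> vanishing B act' -> act' =2 act
      & (forall i : nat, (1 <= i <= N)%N -> q ^+ (2 * i) != 1) ->
        uq_irreducible act].
Proof.
move=> q0 q21 dimV arrB Bval.
have [e [eP eD]] := edge_family arrB.
pose b := row_family q e.
have bP := row_family_entry q0 arrB Bval eP eD; rewrite -/b in bP.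
pose C := q ^+ N; have C0 : C != 0 by rewrite expf_neq0.
have iN (i : 'I_N.+1) : (i <= N)%N by rewrite -ltnS.
have b23 (i : 'I_N.+1) : b i (N - i)%N \in decomp23 B i /\ b i (N - i)%N != 0.
  have [] := bP i (N - i)%N ltac:(by rewrite subnK).
  by rewrite subnK // subnn (entry_loc _ (comp23_sum i)).
have b31 (i : 'I_N.+1) :
    b (N - i)%N 0%N \in decomp31 B i /\ b (N - i)%N 0%N != 0.
  have [] := bP (N - i)%N 0%N ltac:(by rewrite leq_subr).
  by rewrite add0n subKn // (entry_loc _ (comp31_sum i)).
have b12 (i : 'I_N.+1) : e i \in decomp12 B i /\ e i != 0.
  by have := eP i (iN i); rewrite (entry_loc _ (comp12_sum i)).
have basis23 : basis_of fullv (mktuple (fun i : 'I_N.+1 => b i (N - i)%N)).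
  apply: (edge_basis (f := fun i => loc (comp23_sum i)) (eta := 0) arrB) => //.
  - by move=> i j /(congr1 (@coords N)); rewrite !coords_loc => -[_ /ord_inj].
  - by move=> i; case: (b23 i).
  - by move=> i; case: (b23 i).
have basis31 : basis_of fullv (mktuple (fun i : 'I_N.+1 => b (N - i)%N 0%N)).
  apply: (edge_basis (f := fun i => loc (comp31_sum i)) (eta := 1) arrB) => //.
  - by move=> i j /(congr1 (@coords N)); rewrite !coords_loc => -[/ord_inj].
  - by move=> i; case: (b31 i).
  - by move=> i; case: (b31 i).
have basis12 : basis_of fullv (mktuple (fun i : 'I_N.+1 => e i)).
  apply: (edge_basis (f := fun i => loc (comp12_sum i)) (eta := 2%:R)
    arrB) => //.
  - by move=> i j /(congr1 (@coords N)); rewrite !coords_loc => -[_ /ord_inj].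
  - by move=> i; case: (b12 i).
  - by move=> i; case: (b12 i).
have [X Xe] := endo_with_values_leq (fun i =>
  (q ^+ i ^+ 2 / C) *: e i + (C - q ^+ i ^+ 2 / C) *: e i.+1) basis12.
have [Y Ye] := endo_with_values_leq (fun i =>
  (q ^+ i ^+ 2 / C) *: e i + ((1 - q ^+ i ^+ 2) / C) *: e i.-1) basis12.
have [Z Ze] := endo_with_values_leq (fun i => (C / q ^+ i ^+ 2) *: e i) basis12.
have comp_eigenvalue (i : 'I_N.+1) :
    q ^+ (N - i) ^+ 2 / C = C / q ^+ i ^+ 2.
  have -> : C = q ^+ (N - i) * q ^+ i by rewrite -exprD subnK.
  have : q ^+ (N - i) != 0 by rewrite expf_neq0.
  have : q ^+ i != 0 by rewrite expf_neq0.
  by move: (q ^+ i) (q ^+ _) => a a' a0 a'0; field; rewrite a0 a'0.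
have Xb (i : 'I_N.+1) : X (b i (N - i)%N) = (C / q ^+ i ^+ 2) *: b i (N - i)%N.
  rewrite (raising_row q0 Xe) ?subnK // -/C -/b.
  by rewrite comp_eigenvalue subrr scale0r addr0.
have Yb t : (t <= N)%N -> Y (b t 0%N) = (q ^+ t ^+ 2 / C) *: b t 0%N.
  move=> tN; rewrite (lowering_row q0 Ye) // expr0 expr1n mul1r.
  by rewrite subrr mulr0 mul0r scale0r addr0.
have Yb' (i : 'I_N.+1) :
    Y (b (N - i)%N 0%N) = (C / q ^+ i ^+ 2) *: b (N - i)%N 0%N.
  by rewrite Yb ?leq_subr // comp_eigenvalue.
have [Yi Yie] := endo_with_values basis31 (fun i : 'I_N.+1 =>
  (C / q ^+ i ^+ 2)^-1 *: b (N - i)%N 0%N).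
have y0 (i : 'I_N.+1) : C / q ^+ i ^+ 2 != 0.
  by rewrite mulf_neq0 ?invr_eq0 ?expf_neq0.
have YYi v : Y (Yi v) = v.
  rewrite -[RHS]id_lfunE -[LHS]comp_lfunE; move: v.
  apply: (linear_eq_on_basis basis31) => [||i]; try exact: linearP.
  by rewrite comp_lfunE id_lfunE /= Yie linearZ /= Yb' scalerA mulVf // scale1r.
have YiY v : Yi (Y v) = v.
  rewrite -[RHS]id_lfunE -[LHS]comp_lfunE; move: v.
  apply: (linear_eq_on_basis basis31) => [||i]; try exact: linearP.
  by rewrite comp_lfunE id_lfunE /= Yb' linearZ /= Yie scalerA mulfV // scale1r.
have [act [mact actX actY actZ]] := Uq_module_exists YYi YiY
  (model_XY q0 basis12 Xe Ye q21) (model_YZ q0 basis12 Ye Ze q21)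
  (model_ZX q0 basis12 Xe Ze q21).
exists act; split; first split=> //.
- move=> i; rewrite exprz_component // -/C.
  have spans l u v : u \in B l /\ u != 0 -> v \in B l -> exists k, v = k *: u.
    by case=> uB u0 vB; exact: (nonzero_spans arrB uB u0 vB).
  split=> v.
  + move/(spans _ _ _ (b23 i)) => [k ->].
    by rewrite actX linearZ /= Xb !scalerA mulrC subrr.
  + move/(spans _ _ _ (b31 i)) => [k ->].
    by rewrite actY linearZ /= Yb' !scalerA mulrC subrr.
  + move/(spans _ _ _ (b12 i)) => [k ->].
    by rewrite actZ linearZ /= Ze // !scalerA mulrC subrr.
- move=> act' mact' van.
  apply: (Uq_module_eq mact mact') => v.
  + move: v; apply: (linear_eq_on_basis basis23) => [||i];
      try exact: Uq_module_linear.
    have [/(_ _ (b23 i).1)/subr0_eq -> _ _] := van i.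
    by rewrite actX Xb exprz_component.
  + move: v; apply: (linear_eq_on_basis basis31) => [||i];
      try exact: Uq_module_linear.
    have [_ /(_ _ (b31 i).1)/subr0_eq -> _] := van i.
    by rewrite actY Yb' exprz_component.
  + move: v; apply: (linear_eq_on_basis basis12) => [||i];
      try exact: Uq_module_linear.
    have [_ _ /(_ _ (b12 i).1)/subr0_eq ->] := van i.
    by rewrite actZ Ze // exprz_component.
- move=> q_ord; split; first by rewrite -dimv_eq0 dimV.
  move=> W stabW.
  apply: (stable_subspace_trivial q0 basis12 Xe Ye Ze q_ord) => w wW.
  + by rewrite -actX stabW.
  + by rewrite -actY stabW.
  + by rewrite -actZ stabW.
Qed.
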